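(* Let $X$ be a Radon plane and let $0\le\nu\le1$. Then $H_\nu(X,B)=\frac32$ if and only if $S_X$ is an affine regular hexagon.
   Context: $S_X$ is the unit sphere of $X$. For $x,y\in X$, $x\perp_B y$ (Birkhoff orthogonality) means $\|x+\lambda y\|\ge\|x\|$ for all real $\lambda$. For $0\le\nu\le1$, $$H_\nu(X,B)=\sup\left\{\frac{\|x+y\|^{\nu}\|x-y\|^{1-\nu}+\|x+y\|^{1-\nu}\|x-y\|^{\nu}}{2}:\ x,y\in S_X,\ x\perp_B y\right\}.$$ A Radon plane is a two-dimensional real normed space in which Birkhoff orthogonality is symmetric ($x\perp_B y$ implies $y\perp_B x$). An affine regular hexagon is the image of (the boundary of) a regular hexagon under an invertible affine map; for a unit sphere $S_X$ this means that $S_X$ is the hexagon with vertices $\pm u,\pm v,\pm(u+v)$ for some $u,v\in S_X$. *)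

(* Defs.v *)
From HB Require Import structures.
From mathcomp Require Import all_boot all_order all_algebra.
From mathcomp Require Import all_classical all_reals all_analysis.

Set Implicit Arguments.
Unset Strict Implicit.
Unset Printing Implicit Defensive.

Import Order.TTheory GRing.Theory Num.Theory.
Import numFieldNormedType.Exports.

Local Open Scope classical_set_scope.
Local Open Scope ring_scope.

Definition unit_sphere (R : realType) (X : normedModType R) : set X :=
  [set x | `|x| = 1].
Arguments unit_sphere {R} X _.

Definition birkhoff_orth (R : realType) (X : normedModType R) (x y : X) : Prop :=
  forall lambda : R, `|x| <= `|x + lambda *: y|.

(* In dimension at least 2 the set is nonempty, and it is bounded by 2, so the
   real-valued [sup] is its least upper bound. *)
Definition H_B (R : realType) (X : normedModType R) (nu : R) : R :=
  sup [set h : R | exists x y : X,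
         [/\ unit_sphere X x, unit_sphere X y, birkhoff_orth x y &
             h = (`|x + y| `^ nu * `|x - y| `^ (1 - nu)
                  + `|x + y| `^ (1 - nu) * `|x - y| `^ nu) / 2]].

(* [Vector.axiom 2 X]: X is linearly isomorphic to ['rV[R]_2]. *)
Definition radon_plane (R : realType) (X : normedModType R) : Prop :=
  inhabited (Vector.axiom 2 X) /\
  forall x y : X, birkhoff_orth x y -> birkhoff_orth y x.

Definition segment (R : realType) (V : lmodType R) (a b : V) : set V :=
  [set (1 - t) *: a + t *: b | t in [set t : R | 0 <= t <= 1]].

Definition hexagon_vertex (R : realType) (k : nat) : 'rV[R]_2 :=
  \row_(j < 2) (if j == 0 then cos (k%:R * pi / 3) else sin (k%:R * pi / 3)).

(* The boundary only; the last edge closes up as vertex 6 is vertex 0. *)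
Definition regular_hexagon (R : realType) : set 'rV[R]_2 :=
  [set p | exists2 k : nat, (k < 6)%N &
     segment (hexagon_vertex R k) (hexagon_vertex R k.+1) p].
Arguments regular_hexagon R _ : clear implicits.

Definition affine_regular_hexagon (R : realType) (X : lmodType R) (S : set X) : Prop :=
  exists (L : {linear 'rV[R]_2 -> X}) (c : X),
    bijective L /\ S = [set c + L p | p in regular_hexagon R].

(* Main.v *)
Require Import Defs.
From HB Require Import structures.
From mathcomp Require Import all_boot all_order all_algebra.
From mathcomp Require Import all_classical all_reals all_analysis.
From mathcomp Require Import ring lra.
Import Order.TTheory GRing.Theory Num.Theory.
Import numFieldNormedType.Exports.
Local Open Scope classical_set_scope.
Local Open Scope ring_scope.

(** Let [x] and [y] be unit vectors with [x] orthogonal to [y], and put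
    [a = `|x + y|], [b = `|x - y|]. In a Radon plane the norm is proportional to
    its rotated dual norm; applied to [x - y] this yields a vector
    [z = p *: x + q *: y] of the unit ball with [p + q = b]. Say [q <= p]. As [x + y] is
    a positive combination of [z] and [y], [p * a <= 1 + p - q], whence
    [p * (a + b) <= 3 * p + (1 - p) * (1 - b)] and [a + b <= 3], because
    [p <= 1 <= b]. When [a + b = 3], the vector [x + (b - 1) *: y] lies on the
    sphere together with the segment joining it to [y], and the symmetry of
    orthogonality forces the rest of the hexagon. The Heinz mean of [a] and [b] is at
    most [(a + b) / 2], and the supremum of [a + b] is attained by compactness; in
    the hexagon, a vertex and the midpoint of an edge parallel to it give
    [a = b = 3 / 2]. *)

(* Abstracting over [f c d = c *: x + d *: y] first lets the atoms [x] and [y]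
   be rewritten without looping. *)
Ltac lincomb x y :=
  let f := fresh "f" in let fx := fresh "fx" in let fy := fresh "fy" in
  let fD := fresh "fD" in let fZ := fresh "fZ" in let fN := fresh "fN" in
  pose (f := fun c d => c *: x + d *: y);
  assert (fx : x = f 1 0) by (by rewrite /f scale1r scale0r addr0);
  assert (fy : y = f 0 1) by (by rewrite /f scale1r scale0r add0r);
  assert (fD : forall a b c d, f a b + f c d = f (a + c) (b + d))
    by (by move=> *; rewrite /f !scalerDl addrACA);
  assert (fZ : forall k a b, k *: f a b = f (k * a) (k * b))
    by (by move=> *; rewrite /f scalerDr !scalerA);
  assert (fN : forall a b, - f a b = f (- a) (- b))
    by (by move=> *; rewrite /f !scaleNr opprD);
  clearbody f; rewrite fx fy ?(fZ, fN, fD);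
  refine (f_equal2 f _ _).

(** * Birkhoff orthogonality and supporting lines of the norm *)

Section Birkhoff.
Context {R : realType} {X : normedModType R}.
Implicit Types x y w : X.

Lemma birkhoff_orth_coef x y (c d : R) :
  birkhoff_orth x y -> `|c| * `|x| <= `|c *: x + d *: y|.
Proof.
move=> xy; have [->|c0] := eqVneq c 0; first by rewrite normr0 mul0r.
have -> : c *: x + d *: y = c *: (x + (d / c) *: y) by lincomb x y; field.
by rewrite normrZ ler_wpM2l.
Qed.

Lemma norm_lincomb_le x y (c d : R) : 0 <= c -> 0 <= d ->
  `|c *: x + d *: y| <= c * `|x| + d * `|y|.
Proof.
by move=> c0 d0; rewrite (le_trans (ler_normD _ _))// !normrZ !ger0_norm.
Qed.

(** By convexity of the norm along a line, every left difference quotient at 0 is at most every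
    right one; the supremum of the left ones is then the slope of a supporting line. *)
Lemma norm_subgradient x y :
  exists k : R, forall s : R, `|x| + k * s <= `|x + s *: y|.
Proof.
pose E := [set k | exists2 h : R, 0 < h & k = (`|x| - `|x - h *: y|) / h].
have slope (h h' : R) : 0 < h -> 0 < h' ->
    (`|x| - `|x - h *: y|) / h <= (`|x + h' *: y| - `|x|) / h'.
  move=> h0 h'0; rewrite ler_pdivrMr// mulrAC ler_pdivlMr//.
  have := norm_lincomb_le (x - h *: y) (x + h' *: y) _ _ (ltW h'0) (ltW h0).
  have -> : h' *: (x - h *: y) + h *: (x + h' *: y) = (h + h') *: x.
    by lincomb x y; ring.
  rewrite normrZ ger0_norm; [nra | lra].
have E0 : E !=set0 by exists ((`|x| - `|x - 1 *: y|) / 1); exists 1.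
exists (sup E) => s.
have [s0|s0|->] := ltgtP s 0; last by rewrite mulr0 scale0r !addr0.
- have : (`|x| - `|x - (- s) *: y|) / (- s) <= sup E.
    apply: ub_le_sup; last by exists (- s); rewrite ?oppr_gt0.
    by exists ((`|x + 1 *: y| - `|x|) / 1) => _ [h h0 ->]; exact: slope.
  rewrite scaleNr opprK ler_pdivrMr ?oppr_gt0//; lra.
- have : sup E <= (`|x + s *: y| - `|x|) / s.
    by apply: ge_sup => // _ [h h0 ->]; exact: slope.
  rewrite ler_pdivlMr//; lra.
Qed.

(* If [k] is a slope of a line supporting [s |-> `|x + s *: y|] at [0], the
   functional [c *: x + d *: y |-> c * `|x| + d * k] is dominated by the norm,
   and its kernel is spanned by the second vector below. *)
Lemma birkhoff_orth_exists x y :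
  exists mu : R, birkhoff_orth x (y + mu *: x).
Proof.
have [->|x0] := eqVneq x 0; first by exists 0 => l; rewrite normr0.
have n0 : 0 < `|x| by rewrite normr_gt0.
have [k kP] := norm_subgradient x y.
have dom_pos (c d : R) : 0 < c -> c * `|x| + d * k <= `|c *: x + d *: y|.
  move=> c0; have -> : c *: x + d *: y = c *: (x + (d / c) *: y).
    by lincomb x y; field; rewrite gt_eqF.
  rewrite normrZ gtr0_norm// (le_trans _ (ler_wpM2l (ltW c0) (kP _)))//.
  by rewrite le_eqVlt; apply/orP; left; apply/eqP; field; rewrite gt_eqF.
have dom (c d : R) : c * `|x| + d * k <= `|c *: x + d *: y|.
  (* Adding [M *: x] makes the first coefficient positive and raises the norm by at most as much as
     the left side, which reduces the claim to [dom_pos]. *)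
  pose M := `|c| + 1.
  have cM : 0 < c + M by rewrite /M; have := ler_norm (- c); rewrite normrN; lra.
  have := dom_pos (c + M) d cM.
  have -> : (c + M) *: x + d *: y = (c *: x + d *: y) + M *: x.
    by lincomb x y; ring.
  have M0 : 0 <= M by rewrite /M addr_ge0.
  have := ler_normD (c *: x + d *: y) (M *: x); rewrite normrZ (ger0_norm M0).
  lra.
exists (- k / `|x|) => l.
have -> : x + l *: (y + (- k / `|x|) *: x) = (1 - l * (k / `|x|)) *: x + l *: y.
  by lincomb x y; ring.
apply: le_trans (dom _ _); rewrite le_eqVlt; apply/orP; left; apply/eqP.
by field; rewrite gt_eqF.
Qed.

End Birkhoff.

(** * Monotonicity from supporting lines *)

(** Over [n] equal steps the increments of [B] telescope, so [f 1 - f 0] is at most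
    [(B 1 - B 0) / n] for every positive [n]. This replaces a derivative test, as norms may fail to
    be differentiable. *)
Lemma le_subdivision {R : realType} (f B : R -> R) :
  (forall s t, s <= t -> f t - f s <= (t - s) * (B t - B s)) -> f 1 <= f 0.
Proof.
move=> fB.
have sub (n k : nat) : (0 < n)%N ->
    f (k%:R / n%:R) - f 0 <= n%:R^-1 * (B (k%:R / n%:R) - B 0).
  move=> n0; elim: k => [|k IH]; first by rewrite mul0r !subrr mulr0.
  have nR : 0 < n%:R :> R by rewrite ltr0n.
  have ii : 0 < n%:R^-1 :> R by rewrite invr_gt0.
  have e : k.+1%:R / n%:R = k%:R / n%:R + n%:R^-1 :> R by rewrite -natr1 mulrDl mul1r.
  have := fB (k%:R / n%:R) (k.+1%:R / n%:R); rewrite e lerDl => /(_ (ltW ii)).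
  rewrite addrAC subrr add0r; lra.
rewrite leNgt; apply/negP => lt01.
have [n nP] : exists n : nat, (B 1 - B 0) / (f 1 - f 0) < n%:R.
  by exists (Num.truncn ((B 1 - B 0) / (f 1 - f 0))).+1; rewrite truncnS_gt.
have := sub n.+1 n.+1 isT.
rewrite divff ?pnatr_eq0// mulrC ler_pdivlMr ?ltr0n//.
move: nP; rewrite ltr_pdivrMr ?subr_gt0// -natr1; nra.
Qed.

(** Heuristically, [N] and the reciprocal of [D] have the same logarithmic slope [mu], so a smooth
    product would be constant. In general the product grows over a step by at most the step length
    times the increment of [mu t * N t]. *)
Lemma mul_supported_le {R : realType} (N D mu : R -> R) :
  (forall t, 0 <= N t) -> (forall t, 0 <= D t <= 1) ->
  (forall s t, (1 + mu t * (s - t)) * N t <= N s) ->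
  (forall s t, (1 + mu t * (s - t)) * D s <= D t) ->
  N 1 * D 1 <= N 0 * D 0.
Proof.
move=> N0 D01 hN hD.
apply: (@le_subdivision _ (fun t => N t * D t) (fun t => mu t * N t)) => s t st.
have /andP[Dt0 Dt1] := D01 t.
have Nst := hN s t; have Nts := hN t s; have Dst := hD t s.
have d0 : 0 <= t - s by lra.
have h1 : N s * ((1 + mu s * (t - s)) * D t) <= N s * D s by exact: ler_wpM2l.
have h2 : N t * D t <= (N s + mu t * N t * (t - s)) * D t.
  by apply: ler_wpM2r => //; lra.
(* Slopes of lines supporting [N] are monotone: combine the inequalities at [s] and at [t]. *)
have B0 : 0 <= (t - s) * (mu t * N t - mu s * N s) by lra.
have := ler_wpM2l B0 Dt1.
lra.
Qed.

(* The norm of [a *: U + b *: V] when the unit sphere is the hexagon with vertices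
   [±U], [±V], [±(U + V)]. *)
Definition hexnorm {R : realType} (a b : R) : R :=
  Num.max `|a| (Num.max `|b| `|a - b|).

(** * Orthogonal pairs in a Radon plane: the bound 3 and its equality case *)

Section Radon.
Context {R : realType} {X : normedModType R}.
Hypothesis sym : forall x y : X, birkhoff_orth x y -> birkhoff_orth y x.

(* Along [p t = x - t *: y], choose [w t = y + mu t *: p t] orthogonal to [p t].
   Both [`|p t|] and [1 / `|w t|] are supported at [t] by affine functions with the
   same logarithmic slope [mu t], so that [`|p t| * `|w t|] cannot increase. *)
Lemma radon_duality (x y : X) : `|x| = 1 -> `|y| = 1 -> birkhoff_orth x y ->
  exists mu : R, `|x - y| * `|mu *: x + (1 - mu) *: y| <= 1.
Proof.
move=> x1 y1 xy.
have /choice[mu muP] : forall t : R, exists m : R,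
    birkhoff_orth (x - t *: y) (y + m *: (x - t *: y)).
  by move=> t; exact: birkhoff_orth_exists.
pose p t := x - t *: y; pose w t := y + mu t *: p t.
(* By symmetry [w t] is orthogonal to [p t], so subtracting [mu t *: p t], which leaves [y], cannot
   shorten it. *)
have w1 t : `|w t| <= 1.
  have := sym _ _ (muP t) (- mu t).
  by rewrite scaleNr addrK y1.
exists (mu 1).
have -> : mu 1 *: x + (1 - mu 1) *: y = w 1.
  by rewrite /w /p; lincomb x y; ring.
have -> : x - y = p 1 by rewrite /p scale1r.
apply: (@le_trans _ _ (`|p 0| * `|w 0|)).
  apply: (@mul_supported_le _ (fun t => `|p t|) (fun t => `|w t|) mu) => //.
  - by move=> t; rewrite normr_ge0 w1.
  - move=> s t.
    have -> : p s = (1 + mu t * (s - t)) *: p t + (t - s) *: w t.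
      by rewrite /w /p; lincomb x y; ring.
    apply: le_trans (birkhoff_orth_coef _ _ _ _ (muP t)).
    by rewrite ler_wpM2r// ler_norm.
  - move=> s t.
    have -> : w t = (1 + mu t * (s - t)) *: w s +
        (mu t - mu s * (1 + mu t * (s - t))) *: p s.
      by rewrite /w /p; lincomb x y; ring.
    apply: le_trans (birkhoff_orth_coef _ _ _ _ (sym _ _ (muP s))).
    by rewrite ler_wpM2r// ler_norm.
by rewrite /p scale0r subr0 x1 mul1r.
Qed.

(** The key is [sum_le]: the functional equal to 1 at [P] and [y] is dominated by the norm, so the
    segment joining them lies on the sphere. Symmetry of orthogonality then makes the difference [V]
    a unit vector, and [P], [y], [V] are consecutive vertices of the hexagon. *)
Lemma hexagon_norm_of_extremal (x y : X) (q : R) :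
  `|x| = 1 -> `|y| = 1 -> birkhoff_orth x y -> 0 <= q <= 1 ->
  `|x + q *: y| <= 1 -> `|x + y| = 2 - q ->
  exists U V : X, forall a b : R,
    `|a *: U + b *: V| = hexnorm a b.
Proof.
move=> x1 y1 xy /andP[q0 q1] P1 xyq.
pose P := x + q *: y; pose V := y - P.
have fx c d : `|c| <= `|c *: x + d *: y|.
  by have := birkhoff_orth_coef _ _ c d xy; rewrite x1 mulr1.
have fy c d : `|d| <= `|c *: x + d *: y|.
  by have := birkhoff_orth_coef _ _ d c (sym _ _ xy); rewrite y1 mulr1 addrC.
have sum_le c d : c + d <= `|c *: P + d *: y|.
  have [q_1|qn1] := eqVneq q 1.
    have -> : c *: P + d *: y = c *: x + (c + d) *: y by rewrite /P q_1; lincomb x y; ring.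
    by rewrite (le_trans (ler_norm _))// fy.
  have q1' : 0 < 1 - q by rewrite subr_gt0 lt_neqAle qn1.
  (* The triangle inequality is an equality for [x + y = P + (1 - q) *: y]. This [K] is large enough
     that [K *: (x + y)] exceeds [c *: P + d *: y] by a nonnegative combination of [P] and [y]. *)
  pose K := `|c| + `|d| / (1 - q).
  have dK : 0 <= `|d| / (1 - q) by rewrite divr_ge0// ltW.
  have Kc : 0 <= K - c by rewrite /K; have := ler_norm c; lra.
  have Kd : 0 <= K * (1 - q) - d.
    rewrite /K mulrDl divfK ?gt_eqF//.
    have := ler_norm d; have := mulr_ge0 (normr_ge0 c) (ltW q1'); lra.
  have K0 : 0 <= K by rewrite /K addr_ge0.
  have : `|K *: (x + y)| <= `|c *: P + d *: y| + ((K - c) * 1 + (K * (1 - q) - d) * 1).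
    have -> : K *: (x + y) =
        (c *: P + d *: y) + ((K - c) *: P + (K * (1 - q) - d) *: y).
      by rewrite /P; lincomb x y; ring.
    rewrite (le_trans (ler_normD _ _))// lerD2l (le_trans (norm_lincomb_le _ _ _ _ _ _))//.
    by rewrite y1 lerD2r ler_wpM2l.
  rewrite normrZ (ger0_norm K0) xyq; lra.
have fs c d : `|c + d| <= `|c *: P + d *: y|.
  rewrite ler_norml sum_le andbT lerNl opprD.
  by apply: le_trans (sum_le _ _) _; rewrite !scaleNr -opprD normrN.
have yV : birkhoff_orth V y.
  apply: sym => l; rewrite y1.
  have -> : y + l *: V = (- l) *: P + (1 + l) *: y by rewrite /V; lincomb P y; ring.
  by apply: le_trans (fs _ _); rewrite addrCA addNr addr0 normr1.
have VP : birkhoff_orth V P.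
  apply: sym => l; apply: le_trans P1 _.
  have -> : P + l *: V = (1 - l) *: P + l *: y by rewrite /V; lincomb P y; ring.
  by apply: le_trans (fs _ _); rewrite subrK normr1.
have V1 : `|V| = 1.
  apply/eqP; rewrite eq_le; apply/andP; split.
    apply: le_trans (yV (- (1 - q))) _.
    have -> : V + - (1 - q) *: y = - x by rewrite /V /P; lincomb x y; ring.
    by rewrite normrN x1.
  have -> : V = (- 1) *: x + (1 - q) *: y by rewrite /V /P; lincomb x y; ring.
  by apply: le_trans (fx _ _); rewrite normrN normr1.
exists P, V => a b.
have tri (A B : X) c d : `|A| <= 1 -> `|B| <= 1 -> `|c *: A + d *: B| <= `|c| + `|d|.
  move=> A1 B1; rewrite (le_trans (ler_normD _ _))// !normrZ.
  by rewrite lerD// ler_piMr.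
(* The upper bounds expand the vector in the pairs of vertices [(P, V)], [(P, y)] and [(y, V)]; for
   each sign pattern one of them equals [hexnorm a b]. *)
have u1 : `|a *: P + b *: V| <= `|a| + `|b| by apply: tri; rewrite ?V1.
have u2 : `|a *: P + b *: V| <= `|a - b| + `|b|.
  have -> : a *: P + b *: V = (a - b) *: P + b *: y by rewrite /V; lincomb P y; ring.
  by apply: tri; rewrite ?y1.
have u3 : `|a *: P + b *: V| <= `|a| + `|b - a|.
  have -> : a *: P + b *: V = a *: y + (b - a) *: V by rewrite /V; lincomb P y; ring.
  by apply: tri; rewrite ?y1 ?V1.
have l1 : `|a| <= `|a *: P + b *: V|.
  have -> : a *: P + b *: V = (a - b) *: P + b *: y by rewrite /V; lincomb P y; ring.
  by have := fs (a - b) b; rewrite subrK.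
have l2 : `|b| <= `|a *: P + b *: V|.
  by have := birkhoff_orth_coef _ _ b a VP; rewrite V1 mulr1 addrC.
have l3 : `|a - b| <= `|a *: P + b *: V|.
  have -> : a *: P + b *: V = (a - b) *: x + (q * a + (1 - q) * b) *: y.
    by rewrite /V /P; lincomb x y; ring.
  exact: fx.
apply/eqP; rewrite /hexnorm eq_le !ge_max l1 l2 l3 !andbT !le_max.
move: u1 u2 u3; rewrite (distrC b a).
case: (ger0P a) => a0; case: (ger0P b) => b0; case: (ger0P (a - b)) => ab u1 u2 u3;
  apply/or3P; first [apply: Or31; lra | apply: Or32; lra | apply: Or33; lra].
Qed.

Lemma radon_norm_sum_le3 (x y : X) :
  `|x| = 1 -> `|y| = 1 -> birkhoff_orth x y ->
  `|x + y| + `|x - y| <= 3 /\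
  (`|x + y| + `|x - y| = 3 -> exists U V : X, forall a b : R,
    `|a *: U + b *: V| = hexnorm a b).
Proof.
move=> x1 y1 xy; have [mu muP] := radon_duality _ _ x1 y1 xy.
move: muP; set b := `|x - y| => muP.
have : exists p q : R, p + q = b /\ `|p *: x + q *: y| <= 1.
  exists (b * mu), (b * (1 - mu)); split; first by ring.
  by rewrite -!scalerA -scalerDr normrZ ger0_norm ?normr_ge0.
move=> [p [q [pqb z1]]] {mu muP}.
wlog qp : x y x1 y1 xy p q @b pqb z1 / q <= p => [th|].
  have [|pq] := leP q p; first exact: th pqb z1.
  have := th y x y1 x1 (sym _ _ xy) q p.
  rewrite distrC (addrC y x) (addrC q p) (addrC (q *: y)); apply => //; exact: ltW.
have p1 : `|p| <= 1.
  by have := birkhoff_orth_coef _ _ p q xy; rewrite x1 mulr1; lra.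
have b1 : 1 <= b by have := xy (-1); rewrite scaleN1r x1.
have p1' : p <= 1 by rewrite (le_trans (ler_norm _)).
have p0 : 0 < p by lra.
have pa : p * `|x + y| <= 1 + (p - q).
  rewrite -{1}(gtr0_norm p0) -normrZ.
  have -> : p *: (x + y) = (p *: x + q *: y) + (p - q) *: y by lincomb x y; ring.
  rewrite (le_trans (ler_normD _ _))// normrZ y1 mulr1 ger0_norm ?subr_ge0//.
  by rewrite lerD2r.
split; first by nra.
move=> ab3.
have /eqP : (1 - p) * (1 - b) = 0 by nra.
(* If [p = 1], then [q = b - 1] and the given vector of the ball is [x + q *: y]. If [b = 1], then
   [x + y] has norm 2 and the coefficient 0 serves. *)
rewrite mulf_eq0 !subr_eq0 => /orP[/eqP p_1|/eqP b_1].
  apply: (@hexagon_norm_of_extremal x y q) => //; first lra.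
    by move: z1; rewrite -p_1 scale1r.
  lra.
apply: (@hexagon_norm_of_extremal x y 0) => //; first lra.
  by rewrite scale0r addr0 x1.
lra.
Qed.

End Radon.

(** * Coordinates, compactness and the extremal pair *)

Section Extremal.
Context {R : realType} {X : normedModType R}.

Lemma plane_span (x y : X) : Vector.axiom 2 X ->
  (forall c d : R, c *: x + d *: y = 0 -> c = 0 /\ d = 0) ->
  forall w : X, exists c d : R, w = c *: x + d *: y.
Proof.
move=> [v vlin [v' vK v'K]] indep w.
have v0 : v 0 = 0.
  by have := vlin (-1) 0 0; rewrite scaler0 addr0 scaleN1r addNr.
have vD c d (a b : X) : v (c *: a + d *: b) = c *: v a + d *: v b.
  by rewrite vlin -[d *: b]addr0 vlin v0 !addr0.
pose A : 'M[R]_2 := \matrix_i (if i == 0 then v x else v y).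
have mulA (u : 'rV[R]_2) : u *m A = u 0 0 *: v x + u 0 1 *: v y.
  rewrite mulmx_sum_row big_ord_recl big_ord1 !rowK.
  by congr (_ + u 0 _ *: _); exact/val_inj.
have Au : A \in unitmx.
  rewrite -row_free_unit; apply: inj_row_free => u.
  rewrite mulA -vD -[X in _ = X -> _]v0 => /(can_inj vK) /indep[u0 u1].
  apply/rowP => -[[|[|//]] i2]; rewrite mxE.
    by rewrite -[RHS]u0; congr (u 0 _); exact/val_inj.
  by rewrite -[RHS]u1; congr (u 0 _); exact/val_inj.
pose u := v w *m invmx A; exists (u 0 0), (u 0 1).
by rewrite -[LHS]vK -(mulmxKV Au (v w)) -/u mulA -vD vK.
Qed.

Lemma birkhoff_orth_indep (x y : X) : `|x| = 1 -> `|y| = 1 ->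
  birkhoff_orth x y -> forall c d : R, c *: x + d *: y = 0 -> c = 0 /\ d = 0.
Proof.
move=> x1 y1 xy c d e.
have c0 : c = 0.
  apply/eqP; rewrite -normr_le0.
  by have := birkhoff_orth_coef _ _ c d xy; rewrite e normr0 x1 mulr1.
split=> //; move: e; rewrite c0 scale0r add0r => /(congr1 (fun z => `|z|)).
by rewrite normrZ y1 mulr1 normr0 => /eqP; rewrite normr_eq0 => /eqP.
Qed.

(** Orthogonality in both directions bounds both coordinates of a unit vector by 1, so the sphere is
    a closed subset of the image of a square. *)
Lemma compact_unit_sphere (x y : X) :
  `|x| = 1 -> `|y| = 1 -> birkhoff_orth x y -> birkhoff_orth y x ->
  (forall w : X, exists c d : R, w = c *: x + d *: y) ->
  compact (unit_sphere X).
Proof.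
move=> x1 y1 xy yx span.
pose f (p : R * R) : X := p.1 *: x + p.2 *: y.
have fc : continuous f.
  move=> p; apply: cvgD; apply: cvgZl; [exact: cvg_fst | exact: cvg_snd].
have K : compact (`[-1, 1] `*` `[-1, 1] : set (R * R)).
  by apply: compact_setX; exact: segment_compact.
apply: (subclosed_compact _ (continuous_compact (continuous_subspaceT fc) K)).
  have -> : unit_sphere X = (fun w : X => `|w|) @^-1` [set r | r = 1] by [].
  apply: preimage_closed; last exact: closed_eq.
  by move=> w _; exact: norm_continuous.
move=> w /= w1; have [c [d wE]] := span w.
exists (c, d); last by rewrite wE.
have cw : `|c| <= 1.
  by have := birkhoff_orth_coef _ _ c d xy; rewrite -wE w1 x1 mulr1.
have dw : `|d| <= 1.
  by have := birkhoff_orth_coef _ _ d c yx; rewrite addrC -wE w1 y1 mulr1.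
by split; rewrite /= in_itv /= -ler_norml.
Qed.

(** Orthogonality is an intersection of closed conditions, one for each [l], so the admissible pairs
    form a compact set. *)
Lemma extremal_orth_pair :
  compact (unit_sphere X) ->
  (exists x y : X, [/\ `|x| = 1, `|y| = 1 & birkhoff_orth x y]) ->
  exists x y : X, [/\ `|x| = 1, `|y| = 1, birkhoff_orth x y &
    forall x' y' : X, `|x'| = 1 -> `|y'| = 1 -> birkhoff_orth x' y' ->
      `|x' + y'| + `|x' - y'| <= `|x + y| + `|x - y|].
Proof.
move=> Sc [x0 [y0 [x01 y01 xy0]]].
pose O := [set p : X * X | birkhoff_orth p.1 p.2].
have Oc : closed O.
  have -> : O = \bigcap_(l in [set: R])
      ((fun p : X * X => `|p.1 + l *: p.2| - `|p.1|) @^-1` [set r | 0 <= r]).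
    apply/seteqP; split=> [p Op l _|p Op l] /=; first by rewrite subr_ge0; exact: Op.
    by rewrite -subr_ge0; exact: Op.
  apply: closed_bigI => l _; apply: preimage_closed; last exact: closed_ge.
  move=> p _; apply: cvgB; apply: cvg_norm; last exact: cvg_fst.
  by apply: cvgD; [exact: cvg_fst | apply: cvgZr; exact: cvg_snd].
pose A := (unit_sphere X `*` unit_sphere X) `&` O.
have Ac : compact A.
  apply: compact_closedI => //; exact: compact_setX.
pose F (p : X * X) := `|p.1 + p.2| + `|p.1 - p.2|.
have Fc : continuous F.
  move=> p; apply: cvgD; apply: cvg_norm; [apply: cvgD | apply: cvgB];
    by [exact: cvg_fst | exact: cvg_snd].
have A0 : A !=set0 by exists (x0, y0).
have [[x y] /set_mem[[/= x1 y1] xy] max] :=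
  compact_EVT_max A0 Ac (continuous_subspaceT Fc).
exists x, y; split=> // x' y' x'1 y'1 xy'.
by apply: (max (x', y')); apply/mem_set.
Qed.

End Extremal.

(** * Heinz means *)

Section HeinzMean.
Context {R : realType}.
Implicit Types a b nu : R.

(** This is Young's inequality with conjugate exponents [nu^-1] and [(1 - nu)^-1]; the endpoints,
    where one exponent degenerates, are computed directly. *)
Lemma powR_weighted_AGM a b nu : 0 <= a -> 0 <= b -> 0 <= nu <= 1 ->
  a `^ nu * b `^ (1 - nu) <= nu * a + (1 - nu) * b.
Proof.
move=> a0 b0 /andP[n0 n1].
have [->|nn0] := eqVneq nu 0.
  by rewrite powRr0 !subr0 powRr1// mul1r mul0r add0r.
have [->|nn1] := eqVneq nu 1.
  by rewrite subrr powRr0 powRr1// mulr1 mul1r mul0r addr0.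
have n0' : 0 < nu by rewrite lt_neqAle eq_sym nn0.
have n1' : 0 < 1 - nu by rewrite subr_gt0 lt_neqAle nn1.
have := @conjugate_powR _ (a `^ nu) (b `^ (1 - nu)) nu^-1 (1 - nu)^-1
  (powR_ge0 _ _) (powR_ge0 _ _).
rewrite !invr_gt0 !invrK => /(_ n0' n1').
by rewrite addrC subrK -!powRrM !mulfV ?gt_eqF// !powRr1// ![_ * a]mulrC ![_ * b]mulrC; apply.
Qed.

Definition heinz_mean nu a b :=
  (a `^ nu * b `^ (1 - nu) + a `^ (1 - nu) * b `^ nu) / 2.

Lemma heinz_mean_le nu a b : 0 <= a -> 0 <= b -> 0 <= nu <= 1 ->
  heinz_mean nu a b <= (a + b) / 2.
Proof.
move=> a0 b0 nu01; rewrite /heinz_mean ler_pM2r ?invr_gt0//.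
have := powR_weighted_AGM a b nu a0 b0 nu01.
have := powR_weighted_AGM b a nu b0 a0 nu01.
rewrite (mulrC (b `^ nu)); lra.
Qed.

Lemma heinz_mean_diag nu a : 0 < a -> heinz_mean nu a a = a.
Proof.
move=> a0; rewrite /heinz_mean -!powRD ?(lt0r_neq0 a0) ?implybT//.
have -> : nu + (1 - nu) = 1 by ring.
by rewrite subrK powRr1 ?ltW//; field.
Qed.

End HeinzMean.

(** * The regular hexagon in linear coordinates *)

Section Hexagon.
Context {R : realType}.
Implicit Types (a b t : R) (p : 'rV[R]_2).

(** Tripling the angle gives [cos pi = -1], that is [(c + 1) * (2 * c - 1) ^+ 2 = 0], and [c] is
    positive. *)
Lemma cos_pi3 : cos (pi / 3) = 1 / 2 :> R.
Proof.
have pi0 := pi_gt0 R; set z : R := pi / 3.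
have c0 : 0 < cos z by apply: cos_gt0_pihalf; rewrite /z; apply/andP; split; lra.
have e : cos (z + z + z) = -1.
  by rewrite -(cospi R); congr cos; rewrite /z; field.
move: e; rewrite !(cosD, sinD); have := cos2Dsin2 z.
move: (cos z) (sin z) c0 => c s c0 cs e.
have s2 : s ^+ 2 = 1 - c ^+ 2 by lra.
have : (c + 1) * (2 * c - 1) ^+ 2 = 0.
  have -> : (c + 1) * (2 * c - 1) ^+ 2 =
      (c * c - s * s) * c - (s * c + c * s) * s + 3 * c * (s ^+ 2 - (1 - c ^+ 2)) + 1.
    by ring.
  by rewrite e s2; ring.
move/eqP; rewrite mulf_eq0 sqrf_eq0 => /orP[/eqP|/eqP]; lra.
Qed.

Local Notation s3 := (sin (pi / 3) : R).

Lemma sin_pi3_gt0 : 0 < s3.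
Proof. have pi0 := pi_gt0 R; apply: sin_gt0_pi; apply/andP; split; lra. Qed.

Local Notation vertex := (hexagon_vertex R).

Lemma hexagon_vertexE k : vertex k =
  \row_(j < 2) (if j == 0 then cos (k%:R * (pi / 3)) else sin (k%:R * (pi / 3))).
Proof. by apply/rowP => j; rewrite !mxE mulrA. Qed.

Lemma hexagon_vertex_add3 k : vertex (k + 3)%N = - vertex k.
Proof.
apply/rowP => j; rewrite !hexagon_vertexE !mxE natrD mulrDl.
have -> : 3%:R * (pi / 3) = pi :> R by field.
by rewrite cosDpi sinDpi; case: ifP.
Qed.

Lemma hexagon_vertex1 : vertex 1 = vertex 0 + vertex 2.
Proof.
apply/rowP => j; rewrite !hexagon_vertexE !mxE !mul0r mul1r mulr_natl mulr2n.
rewrite cosD sinD cos0 sin0; have := cos2Dsin2 (pi / 3 : R).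
rewrite cos_pi3 => e; case: ifP => _; lra.
Qed.

(** Coordinates in the basis [vertex 0], [vertex 2], chosen because [vertex 1] is their sum: the
    hexagon becomes the unit sphere of [hexnorm]. *)
Definition hexcoord0 p : R := p 0 0 + p 0 1 / s3 / 2.
Definition hexcoord1 p : R := p 0 1 / s3.

Lemma hexcoordK p : p = hexcoord0 p *: vertex 0 + hexcoord1 p *: vertex 2.
Proof.
have s0 : s3 != 0 by rewrite gt_eqF ?sin_pi3_gt0.
have e := cos2Dsin2 (pi / 3 : R); rewrite cos_pi3 in e.
apply/rowP => j; rewrite !hexagon_vertexE !mxE !mul0r mulr_natl mulr2n.
rewrite cosD sinD cos0 sin0 cos_pi3 /hexcoord0 /hexcoord1.
case: ifP => [/eqP ->|].
  have -> : 1 / 2 * (1 / 2) - s3 * s3 = - (1 / 2) by lra.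
  by field.
case: j => -[|[|//]] j2 // _; have -> : Ordinal j2 = 1 by exact/val_inj.
by field.
Qed.

Lemma hexcoord_lincomb a b :
  hexcoord0 (a *: vertex 0 + b *: vertex 2) = a /\
  hexcoord1 (a *: vertex 0 + b *: vertex 2) = b.
Proof.
have s0 : s3 != 0 by rewrite gt_eqF ?sin_pi3_gt0.
have e := cos2Dsin2 (pi / 3 : R); rewrite cos_pi3 in e.
rewrite /hexcoord0 /hexcoord1 !hexagon_vertexE !mxE /= !mul0r mulr_natl mulr2n.
rewrite cosD sinD cos0 sin0 cos_pi3.
have -> : 1 / 2 * (1 / 2) - s3 * s3 = - (1 / 2) by lra.
by split; field.
Qed.

(** The conditions are linear, as [lra] requires, and the six alternatives list the edges of the
    hexagon in the order of [k]. *)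
Lemma hexnorm_eq1P a b : hexnorm a b = 1 <->
  [/\ -1 <= a <= 1, -1 <= b <= 1, -1 <= a - b <= 1 &
   [\/ a = 1, b = 1 | b - a = 1] \/ [\/ a = -1, b = -1 | a - b = 1]].
Proof.
rewrite -!ler_norml /hexnorm; split.
  move=> e; split; try by rewrite -e !le_max lexx ?orbT.
  have : [\/ `|a| = 1, `|b| = 1 | `|a - b| = 1].
    move: e; rewrite /Num.max; case: ifP => _; first case: ifP => _ => e.
    - by apply: Or33.
    - by apply: Or32.
    - by move=> e; apply: Or31.
  move=> [] /eqP; rewrite eqr_norml ler01 andbT => /orP[/eqP e1|/eqP e1].
  - by left; apply: Or31.
  - by right; apply: Or31.
  - by left; apply: Or32.
  - by right; apply: Or32.
  - by right; apply: Or33.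
  - by left; apply: Or33; rewrite -opprB e1 opprK.
move=> [a1 b1 ab1 H]; apply/eqP; rewrite eq_le !ge_max a1 b1 ab1 /= !le_max.
case: H => -[] e; rewrite ?e ?normrN ?normr1 ?lexx ?orbT//.
by rewrite distrC e normr1 lexx !orbT.
Qed.

Lemma regular_hexagonP p : regular_hexagon R p <->
  hexnorm (hexcoord0 p) (hexcoord1 p) = 1.
Proof.
have v3 := hexagon_vertex_add3 0; have v4 := hexagon_vertex_add3 1.
have v5 := hexagon_vertex_add3 2; have v6 := hexagon_vertex_add3 3.
move: v3 v4 v5 v6; rewrite /= => v3 v4 v5 v6.
have v1 := hexagon_vertex1.
have vE : [/\ vertex 3 = - vertex 0, vertex 4 = - (vertex 0 + vertex 2),
    vertex 5 = - vertex 2 & vertex 6 = vertex 0].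
  by rewrite v6 v5 v4 v3 v1 opprK.
case: vE => {v3 v4 v5 v6} v3 v4 v5 v6.
have edge a b : p = a *: vertex 0 + b *: vertex 2 ->
    hexnorm (hexcoord0 p) (hexcoord1 p) = hexnorm a b.
  by move=> ->; have [-> ->] := hexcoord_lincomb a b.
split.
- case=> k k6 [t /andP[t0 t1]] pE.
  have [a [b [pab ab1]]] : exists a b : R,
      p = a *: vertex 0 + b *: vertex 2 /\ hexnorm a b = 1; last first.
    by rewrite (edge _ _ pab).
  case: k k6 pE => [|[|[|[|[|[|//]]]]]] _ <-; rewrite ?v6 ?v5 ?v4 ?v3 ?v1.
  + exists 1, t; split; first by lincomb (vertex 0) (vertex 2); ring.
    apply/hexnorm_eq1P; split; [lra | lra | lra | by left; apply: Or31].
  + exists (1 - t), 1; split; first by lincomb (vertex 0) (vertex 2); ring.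
    apply/hexnorm_eq1P; split; [lra | lra | lra | by left; apply: Or32].
  + exists (- t), (1 - t); split; first by lincomb (vertex 0) (vertex 2); ring.
    apply/hexnorm_eq1P; split; [lra | lra | lra | left; apply: Or33; lra].
  + exists (- 1), (- t); split; first by lincomb (vertex 0) (vertex 2); ring.
    apply/hexnorm_eq1P; split; [lra | lra | lra | by right; apply: Or31].
  + exists (t - 1), (- 1); split; first by lincomb (vertex 0) (vertex 2); ring.
    apply/hexnorm_eq1P; split; [lra | lra | lra | by right; apply: Or32].
  + exists t, (t - 1); split; first by lincomb (vertex 0) (vertex 2); ring.
    apply/hexnorm_eq1P; split; [lra | lra | lra | right; apply: Or33; lra].
- have pE := hexcoordK p; move: (hexcoord0 p) (hexcoord1 p) pE => a b {edge}-> /hexnorm_eq1P.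
  move=> [] /andP[a1 a2] /andP[b1 b2] /andP[ab1 ab2] [] [] e.
  + exists 0%N => //; exists b; first by apply/andP; split; lra.
    by rewrite v1 e; lincomb (vertex 0) (vertex 2); ring.
  + exists 1%N => //; exists (1 - a); first by apply/andP; split; lra.
    by rewrite v1 e; lincomb (vertex 0) (vertex 2); ring.
  + exists 2%N => //; exists (- a); first by apply/andP; split; lra.
    have -> : b = 1 + a by lra.
    by rewrite v3; lincomb (vertex 0) (vertex 2); ring.
  + exists 3%N => //; exists (- b); first by apply/andP; split; lra.
    by rewrite v3 v4 e; lincomb (vertex 0) (vertex 2); ring.
  + exists 4%N => //; exists (1 + a); first by apply/andP; split; lra.
    by rewrite v4 v5 e; lincomb (vertex 0) (vertex 2); ring.
  + exists 5%N => //; exists a; first by apply/andP; split; lra.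
    have -> : b = a - 1 by lra.
    by rewrite v5 v6; lincomb (vertex 0) (vertex 2); ring.
Qed.

End Hexagon.

(** * Linear images of the regular hexagon *)

Section HexagonMap.
Context {R : realType} {X : lmodType R} (U V : X).

(** The linear map taking [hexagon_vertex R 0] to [U] and [hexagon_vertex R 2] to [V]. *)
Definition hexagon_map (p : 'rV[R]_2) : X := hexcoord0 p *: U + hexcoord1 p *: V.

Lemma hexagon_map_is_linear : linear hexagon_map.
Proof.
move=> k p q; rewrite /hexagon_map /hexcoord0 /hexcoord1 !mxE.
by lincomb U V; ring.
Qed.

HB.instance Definition _ := GRing.isLinear.Build R 'rV[R]_2 X *:%R
  hexagon_map hexagon_map_is_linear.

Lemma hexagon_map_bij :
  (forall c d : R, c *: U + d *: V = 0 -> c = 0 /\ d = 0) ->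
  (forall w : X, exists c d : R, w = c *: U + d *: V) ->
  bijective hexagon_map.
Proof.
move=> indep span.
have /choice[g gP] : forall w : X, exists cd : R * R, w = cd.1 *: U + cd.2 *: V.
  by move=> w; have [c [d wE]] := span w; exists (c, d).
pose h w := (g w).1 *: hexagon_vertex R 0 + (g w).2 *: hexagon_vertex R 2.
have hK w : hexagon_map (h w) = w.
  by rewrite /hexagon_map /h; have [-> ->] := hexcoord_lincomb (g w).1 (g w).2; rewrite -gP.
have ker p : hexagon_map p = 0 -> p = 0.
  by move=> /indep[p0 p1]; rewrite (hexcoordK p) p0 p1 !scale0r addr0.
exists h => // p; apply/eqP; rewrite -subr_eq0; apply/eqP/ker.
by rewrite linearB /= hK subrr.
Qed.

End HexagonMap.

(** * Hexagonal unit spheres *)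

Section HexagonalSphere.
Context {R : realType} {X : normedModType R}.

Lemma affine_hexagon_of_hexnorm (U V : X) :
  Vector.axiom 2 X -> (forall a b : R, `|a *: U + b *: V| = hexnorm a b) ->
  affine_regular_hexagon (unit_sphere X).
Proof.
move=> dim2 UV.
have indep (c d : R) : c *: U + d *: V = 0 -> c = 0 /\ d = 0.
  move=> e; have := UV c d; rewrite e normr0 => h0.
  have : (`|c| <= 0) && (`|d| <= 0) by rewrite h0 !le_max !lexx !orbT.
  by rewrite !normr_le0 => /andP[/eqP ? /eqP ?].
have span := plane_span U V dim2 indep.
exists (hexagon_map U V), 0; split; first exact: hexagon_map_bij.
apply/seteqP; split=> [w w1|_ [p /regular_hexagonP p1 <-]]; last first.
  by rewrite /unit_sphere /= add0r UV.
have [c [d wE]] := span w.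
have [e0 e1] := hexcoord_lincomb c d.
exists (c *: hexagon_vertex R 0 + d *: hexagon_vertex R 2).
  by apply/regular_hexagonP; rewrite e0 e1 -UV -wE.
by rewrite add0r /= /hexagon_map e0 e1 wE.
Qed.

Lemma hexagon_sphere_basis : affine_regular_hexagon (unit_sphere X) ->
  exists U V : X, forall a b : R, hexnorm a b = 1 -> `|a *: U + b *: V| = 1.
Proof.
move=> [L [c [Lbij SE]]].
pose U := L (hexagon_vertex R 0); pose V := L (hexagon_vertex R 2).
have LE a b : L (a *: hexagon_vertex R 0 + b *: hexagon_vertex R 2) = a *: U + b *: V.
  by rewrite linearD !linearZ.
have inS a b : hexnorm a b = 1 -> `|c + (a *: U + b *: V)| = 1.
  move=> ab; have : unit_sphere X (c + (a *: U + b *: V)).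
    rewrite SE; exists (a *: hexagon_vertex R 0 + b *: hexagon_vertex R 2).
      by apply/regular_hexagonP; have [-> ->] := hexcoord_lincomb a b.
    by rewrite LE.
  by [].
have [c0 [c1 cE]] : exists c0 c1 : R, c = c0 *: U + c1 *: V.
  case: Lbij => M MK KM; exists (hexcoord0 (M c)), (hexcoord1 (M c)).
  by rewrite -LE -hexcoordK KM.
(* Symmetry of the sphere about [0] makes the hexagon invariant under the
   translation by [- 2 *: c], which its boundedness excludes unless [c = 0]. *)
have shift a b : hexnorm a b = 1 -> hexnorm (- a - 2 * c0) (- b - 2 * c1) = 1.
  move=> ab; have : unit_sphere X (- (c + (a *: U + b *: V))).
    by rewrite /unit_sphere /= normrN inS.
  rewrite SE => -[p /regular_hexagonP p1 pE].
  have : L p = L ((- a - 2 * c0) *: hexagon_vertex R 0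
                + (- b - 2 * c1) *: hexagon_vertex R 2).
    apply: (addrI c); rewrite pE LE cE; lincomb U V; ring.
  move=> /(bij_inj Lbij) e; move: p1; rewrite e.
  by have [-> ->] := hexcoord_lincomb (- a - 2 * c0) (- b - 2 * c1).
have n10 : hexnorm 1 0 = 1 :> R.
  by apply/hexnorm_eq1P; split; [lra | lra | lra | left; apply: Or31].
have n10' : hexnorm (-1) 0 = 1 :> R.
  by apply/hexnorm_eq1P; split; [lra | lra | lra | right; apply: Or31].
have n01 : hexnorm 0 1 = 1 :> R.
  by apply/hexnorm_eq1P; split; [lra | lra | lra | left; apply: Or32].
have n01' : hexnorm 0 (-1) = 1 :> R.
  by apply/hexnorm_eq1P; split; [lra | lra | lra | right; apply: Or32].
have c_0 : c = 0.
  have /hexnorm_eq1P[h1 h2 _ _] := shift _ _ n10.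
  have /hexnorm_eq1P[h3 h4 _ _] := shift _ _ n10'.
  have /hexnorm_eq1P[h5 h6 _ _] := shift _ _ n01.
  have /hexnorm_eq1P[h7 h8 _ _] := shift _ _ n01'.
  have c00 : c0 = 0 by lra.
  have c10 : c1 = 0 by lra.
  by rewrite cE c00 c10 !scale0r addr0.
by exists U, V => a b /inS; rewrite c_0 add0r.
Qed.

Lemma hexagon_extremal_pair (U V : X) :
  (forall x y : X, birkhoff_orth x y -> birkhoff_orth y x) ->
  (forall a b : R, hexnorm a b = 1 -> `|a *: U + b *: V| = 1) ->
  exists x y : X, [/\ `|x| = 1, `|y| = 1, birkhoff_orth x y &
    `|x + y| = 3 / 2 /\ `|x - y| = 3 / 2].
Proof.
move=> sym UV; pose y := V + (1 / 2) *: U.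
have U1 : `|U| = 1.
  rewrite -[U]addr0 -{1}(scale1r U) -(scale0r V); apply/UV/hexnorm_eq1P.
  by split; [lra | lra | lra | left; apply: Or31].
have edge t : -1 / 2 <= t <= 1 / 2 -> `|y + t *: U| = 1.
  move=> t1; have -> : y + t *: U = (1 / 2 + t) *: U + 1 *: V.
    by rewrite /y; lincomb U V; ring.
  by apply/UV/hexnorm_eq1P; split; [lra | lra | lra | left; apply: Or32].
have y1 : `|y| = 1 by rewrite -[y]addr0 -(scale0r U) edge//; lra.
exists U, y; split=> //.
  apply: sym => l; rewrite y1.
  (* The condition on [m] and [u] makes [y] a convex combination of [y + l *: U] and the edge point
     [y + u *: U]. As [y] and the edge point have norm 1, the other point has norm at least 1. The
     end of the edge on the side opposite to [l] is used. *)
  have far (m u : R) : 0 <= m -> -1 / 2 <= u <= 1 / 2 -> l / 2 + m * u = 0 ->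
      1 <= `|y + l *: U|.
    move=> m0 u1 lmu.
    have := norm_lincomb_le (y + l *: U) (y + u *: U) (1 / 2) m.
    have -> : (1 / 2) *: (y + l *: U) + m *: (y + u *: U) = (1 / 2 + m) *: y.
      by lincomb y U; lra.
    rewrite normrZ y1 (edge u)// ger0_norm; lra.
  have [l0|l0] := lerP 0 l; [apply: (far l (-1 / 2)) | apply: (far (- l) (1 / 2))]; lra.
split.
- have -> : U + y = (3 / 2) *: (1 *: U + (2 / 3) *: V) by rewrite /y; lincomb U V; field.
  rewrite normrZ UV ?mulr1; first by rewrite ger0_norm; lra.
  by apply/hexnorm_eq1P; split; [lra | lra | lra | left; apply: Or31].
- have -> : U - y = (3 / 2) *: ((1 / 3) *: U + (- (2 / 3)) *: V) by rewrite /y; lincomb U V; field.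
  rewrite normrZ UV ?mulr1; first by rewrite ger0_norm; lra.
  by apply/hexnorm_eq1P; split; [lra | lra | lra | right; apply: Or33; lra].
Qed.

End HexagonalSphere.

Theorem theorem3p4 (R : realType) (X : normedModType R) (nu : R)
    (radonX : radon_plane X) (nu01 : 0 <= nu <= 1) :
  H_B X nu = 3 / 2 <-> affine_regular_hexagon (unit_sphere X).
Proof.
have [[dim2] sym] := radonX.
rewrite /H_B; set E := [set h : R | _].
have mean_le h : E h -> exists x y : X, [/\ `|x| = 1, `|y| = 1, birkhoff_orth x y &
    h <= (`|x + y| + `|x - y|) / 2].
  by move=> [x [y [x1 y1 xy ->]]]; exists x, y; split=> //; exact: heinz_mean_le.
split=> [supE|].
- have [h0 Eh0] : E !=set0.
    (* The supremum of the empty set is 0 by default, which differs from 3 / 2. *)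
    apply/set0P/eqP => E0; move: supE; rewrite E0 sup0; lra.
  have [x0 [y0 [x01 y01 xy0 _]]] := mean_le _ Eh0.
  have span := plane_span x0 y0 dim2 (birkhoff_orth_indep _ _ x01 y01 xy0).
  have Sc := compact_unit_sphere _ _ x01 y01 xy0 (sym _ _ xy0) span.
  have [] := extremal_orth_pair Sc; first by exists x0, y0.
  move=> x [y [x1 y1 xy max]].
  have [le3 eq3] := radon_norm_sum_le3 sym _ _ x1 y1 xy.
  (* With the bound 3, this forces the maximizing pair to have sum exactly 3. *)
  have ge3 : sup E <= (`|x + y| + `|x - y|) / 2.
    apply: ge_sup; first by exists h0.
    move=> h /mean_le[x' [y' [x'1 y'1 xy' hle]]]; apply: le_trans hle _.
    by rewrite ler_pM2r ?invr_gt0// max.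
  have [|U [V UV]] := eq3; first by lra.
  exact: (affine_hexagon_of_hexnorm U V).
- move=> /hexagon_sphere_basis[U [V UV]].
  have [x [y [x1 y1 xy [xy32 xy32']]]] := hexagon_extremal_pair _ _ sym UV.
  have ub : ubound E (3 / 2).
    move=> h /mean_le[x' [y' [x'1 y'1 xy' hle]]].
    have [le3 _] := radon_norm_sum_le3 sym _ _ x'1 y'1 xy'; lra.
  have E32 : E (3 / 2).
    exists x, y; split=> //; rewrite xy32 xy32'.
    by rewrite -[LHS](heinz_mean_diag nu)//; lra.
  apply/eqP; rewrite eq_le ge_sup//=; last by exists (3 / 2).
  by apply: ub_le_sup => //; exists (3 / 2).
Qed.
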